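(* Let $N\geq 2$ be an integer, let $s>1$ and $p>0$, and let $\beta_0=\beta_0(N,s)\in(0,1)$ be the constant described in the context. If $E\subset\mathbb{R}^N$ is bounded and $$S_E^{s,p}:=\sum_{Q\in\Delta(\mathbb{R}^N)}\beta_E(3Q)^p(\operatorname{diam}Q)^s<\infty,$$ then $E$ is contained in a $(1/s)$-Hölder curve. More precisely, there is a constant $C$ depending only on $N$ and $s$ such that for every such $E$ we have $E\subset\Gamma=f([0,1])$ for some map $f:[0,1]\to\mathbb{R}^N$ satisfying $|f(x)-f(y)|\leq H|x-y|^{1/s}$ for all $x,y\in[0,1]$, with $$H\leq C\left(\operatorname{diam}E+\beta_0^{-p}(\operatorname{diam}E)^{1-s}S_E^{s,p}\right).$$
   Context: $\Delta(\mathbb{R}^N)$ is the family of dyadic cubes $[2^k m_1,2^k(m_1+1)]\times\cdots\times[2^k m_N,2^k(m_N+1)]$ with $m_1,\dots,m_N,k\in\mathbb{Z}$. For a cube $Q$ and $\lambda>0$, $\lambda Q$ is the concentric dilate of $Q$ by the factor $\lambda$. For a nonempty set $E\subset\mathbb{R}^N$ and a bounded set $Q\subset\mathbb{R}^N$ of positive diameter, the Jones beta number is $$\beta_E(Q):=\inf_{\ell}\sup_{x\in E\cap Q}\frac{\operatorname{dist}(x,\ell)}{\operatorname{diam}Q}\in[0,1]$$ if $E\cap Q\neq\emptyset$, where $\ell$ ranges over all straight lines in $\mathbb{R}^N$, and $\beta_E(Q):=0$ if $E\cap Q=\emptyset$. A $(1/s)$-Hölder curve in $\mathbb{R}^N$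 is the image of a map $f:[0,1]\to\mathbb{R}^N$ with $|f(x)-f(y)|\leq H|x-y|^{1/s}$ for all $x,y\in[0,1]$ and some finite constant $H$. The constant $\beta_0$: for given $N\geq 2$ and $s>1$ there exists $\beta_0\in(0,1)$, depending only on $N$ and $s$, with the following property. If $E\subset\mathbb{R}^N$ is bounded and $S_E^{s,+}:=\sum_{Q\in\Delta(\mathbb{R}^N),\,\beta_E(3Q)\geq\beta_0}(\operatorname{diam}Q)^s<\infty$, then $E\subset f([0,1])$ for some $(1/s)$-Hölder map $f:[0,1]\to\mathbb{R}^N$ with Hölder constant at most $C(N,s)\left(\operatorname{diam}E+(\operatorname{diam}E)^{1-s}S_E^{s,+}\right)$. Here $\beta_0$ denotes such a constant, fixed once and for all for each $N$ and $s$. Sets $E$ are assumed nonempty; if $\operatorname{diam}E=0$, then $S_E^{s,+}=S_E^{s,p}=0$ and the products $(\operatorname{diam}E)^{1-s}S_E^{s,+}$ and $(\operatorname{diam}E)^{1-s}S_E^{s,p}$ are read as $0$. *)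

(* Defs.v *)
From mathcomp Require Import all_boot all_order all_algebra.
From mathcomp Require Import all_classical all_reals all_analysis.

Set Implicit Arguments.
Unset Strict Implicit.
Unset Printing Implicit Defensive.

Import Order.TTheory GRing.Theory Num.Theory.
Import numFieldNormedType.Exports.

Local Open Scope classical_set_scope.
Local Open Scope ring_scope.

Section EuclideanGeometry.
Context {R : realType} {N : nat}.
Implicit Types (E Q l : set 'rV[R]_N).

(* The norm that 'rV[R]_N carries in the library is the sup norm; all metric
   quantities below use the Euclidean norm instead. *)
Definition enorm (x : 'rV[R]_N) : R := Num.sqrt (\sum_i x ord0 i ^+ 2).

(* [sup] and [inf] are real-valued (0 on sets without a supremum or infimum);
   in this file they are only meaningful, and only used, for nonempty bounded
   sets of reals. *)
Definition diam Q : R :=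
  sup [set d | exists2 x, Q x & exists2 y, Q y & d = enorm (x - y)].

Definition dist (x : 'rV[R]_N) l : R := inf [set enorm (x - y) | y in l].

Definition straight_lines : set (set 'rV[R]_N) :=
  [set l | exists a v : 'rV[R]_N, v != 0 /\ l = range (fun t : R => a + t *: v)].

Definition beta E Q : R :=
  if E `&` Q == set0 then 0
  else inf [set sup [set dist x l / diam Q | x in E `&` Q] | l in straight_lines].

(* Dyadic cubes are indexed by (k, m); lemma [dyadic_cube_inj] below shows that
   distinct indices give distinct cubes when N > 0, so that a sum over indices
   is a sum over cubes. *)
Definition dyadic_cube (q : int * 'rV[int]_N) : set 'rV[R]_N :=
  [set x | forall i, 2 ^ q.1 * (q.2 ord0 i)%:~R <= x ord0 i
                     <= 2 ^ q.1 * (q.2 ord0 i + 1)%:~R].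

Definition dyadic_center (q : int * 'rV[int]_N) : 'rV[R]_N :=
  \row_i (2 ^ q.1 * ((q.2 ord0 i)%:~R + 2^-1)).

Definition dilated_cube (lambda : R) (q : int * 'rV[int]_N) : set 'rV[R]_N :=
  [set dyadic_center q + lambda *: (x - dyadic_center q) | x in dyadic_cube q].

Definition S_plus (s beta0 : R) E : \bar R :=
  \esum_(q in [set q | beta0 <= beta E (dilated_cube 3 q)])
    (diam (dyadic_cube q) `^ s)%:E.

Definition S_pow (s p : R) E : \bar R :=
  \esum_(q in [set: int * 'rV[int]_N])
    (beta E (dilated_cube 3 q) `^ p * diam (dyadic_cube q) `^ s)%:E.

Definition holder_map (s H : R) (f : R -> 'rV[R]_N) : Prop :=
  forall x y, x \in `[0, 1] -> y \in `[0, 1] ->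
    enorm (f x - f y) <= H * `|x - y| `^ s^-1.

Definition holder_curve (s : R) (Gamma : set 'rV[R]_N) : Prop :=
  exists H f, holder_map s H f /\ Gamma = f @` `[0, 1].

End EuclideanGeometry.

(* [bounded_set] refers to the sup norm, which has the same bounded sets as the
   Euclidean norm. Since [0 `^ (1 - s) = 0] when s <> 1, the products with
   [diam E `^ (1 - s)] vanish when diam E = 0. *)
Definition beta0_property (R : realType) (N : nat) (s beta0 : R) : Prop :=
  exists C : R, forall E : set 'rV[R]_N,
    E !=set0 -> bounded_set E -> (S_plus s beta0 E < +oo)%E ->
    exists H (f : R -> 'rV[R]_N),
      [/\ holder_map s H f,
          E `<=` f @` `[0, 1] &
          H <= C * (diam E + diam E `^ (1 - s) * fine (S_plus s beta0 E))].

Section DyadicIndexing.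
Variables (R : realType) (N : nat).

Lemma dyadic_cube_sub (q q' : int * 'rV[int]_N) i :
  @dyadic_cube R N q `<=` dyadic_cube q' ->
  2 ^ q'.1 * (q'.2 ord0 i)%:~R <= 2 ^ q.1 * (q.2 ord0 i)%:~R :> R /\
  2 ^ q.1 * (q.2 ord0 i + 1)%:~R <= 2 ^ q'.1 * (q'.2 ord0 i + 1)%:~R :> R.
Proof.
have le01 (k m : int) : 2 ^ k * m%:~R <= 2 ^ k * (m + 1)%:~R :> R.
  by rewrite ler_pM2l ?exprz_gt0// ler_int lerDl.
move=> sub; split.
  have /sub/(_ i) : @dyadic_cube R N q (\row_j (2 ^ q.1 * (q.2 ord0 j)%:~R)).
    by move=> j; rewrite mxE lexx le01.
  by rewrite mxE => /andP[].
have /sub/(_ i) : @dyadic_cube R N q (\row_j (2 ^ q.1 * (q.2 ord0 j + 1)%:~R)).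
  by move=> j; rewrite mxE lexx le01.
by rewrite mxE => /andP[].
Qed.

Lemma dyadic_cube_inj : (0 < N)%N -> injective (@dyadic_cube R N).
Proof.
move=> N0 [k m] [k' m'] e.
have sub : @dyadic_cube R N (k, m) `<=` dyadic_cube (k', m') by rewrite e.
have sub' : @dyadic_cube R N (k', m') `<=` dyadic_cube (k, m) by rewrite e.
have lo i : 2 ^ k * (m ord0 i)%:~R = 2 ^ k' * (m' ord0 i)%:~R :> R.
  have [/= lo _] := dyadic_cube_sub i sub; have [/= lo' _] := dyadic_cube_sub i sub'.
  by apply/le_anti; rewrite lo lo'.
have hi i : 2 ^ k * (m ord0 i + 1)%:~R = 2 ^ k' * (m' ord0 i + 1)%:~R :> R.
  have [/= _ hi] := dyadic_cube_sub i sub; have [/= _ hi'] := dyadic_cube_sub i sub'.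
  by apply/le_anti; rewrite hi hi'.
have ek : k = k'.
  have := hi (Ordinal N0); rewrite !intrD !mulrDr lo !mulr1 => /addrI.
  by apply: ieexprIz; rewrite ?ltr0n// gt_eqF// ltr1n.
rewrite -ek in lo *; congr (_, _); apply/rowP => i; have := lo i.
by move=> /mulfI; rewrite gt_eqF ?exprz_gt0// => /(_ isT)/intr_inj.
Qed.

End DyadicIndexing.

(* Main.v *)
Require Import Defs.
From mathcomp Require Import all_boot all_order all_algebra.
From mathcomp Require Import all_classical all_reals all_analysis.
Import Order.TTheory GRing.Theory Num.Theory.
Import numFieldNormedType.Exports.
Local Open Scope classical_set_scope.
Local Open Scope ring_scope.

(** The result follows from the property of [beta0] by a Chebyshev-type
    estimate. On the cubes counted in [S_plus s beta0 E] the beta number is at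
    least [beta0], hence [1 <= beta0 `^ (- p) * beta E (3Q) `^ p]; multiplying
    by [diam Q `^ s], summing over these cubes, and extending the sum to all
    dyadic cubes gives
    [S_plus s beta0 E <= beta0 `^ (- p) * S_pow s p E] ([S_plus_le_S_pow]).
    In particular [S_plus s beta0 E] is finite, so [beta0_property] provides
    the Holder map, and its bound on the Hölder constant turns into the
    required one. The constant [C] of [beta0_property] is replaced by its
    absolute value, so that the bound is monotone in the sum. *)

Lemma sup_nonneg (R : realType) (A : set R) :
  (forall x, A x -> 0 <= x) -> 0 <= sup A.
Proof.
move=> A0; have [[[x Ax] ubA]|/sup_out->//] := pselect (has_sup A).
apply: le_trans (A0 _ Ax) _; exact: ub_le_sup.
Qed.

Lemma diam_ge0 (R : realType) (N : nat) (Q : set 'rV[R]_N) : 0 <= diam Q.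
Proof.
by apply: sup_nonneg => _ [x _ [y _ ->]]; exact: sqrtr_ge0.
Qed.

Lemma esum_le_pmul (R : realType) (T : choiceType) (I J : set T)
    (c : R) (a b : T -> \bar R) :
  0 <= c -> I `<=` J -> (forall i, 0 <= b i)%E ->
  (forall i, I i -> a i <= c%:E * b i)%E ->
  (\esum_(i in I) a i <= c%:E * \esum_(i in J) b i)%E.
Proof.
move=> c0 IJ b0 ab; apply: ge_ereal_sup => _ [X [finX XI] <-].
apply: (@le_trans _ _ (\sum_(i \in X) c%:E * b i)%E).
  by apply: lee_fsum => // i /XI /ab.
rewrite -ge0_mule_fsumr //.
apply: lee_wpmul2l; first by rewrite lee_fin.
by apply: esum_ge; exists X => //; split => // i /XI /IJ.
Qed.

Lemma S_plus_le_S_pow (R : realType) (N : nat) (s p beta0 : R)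
    (E : set 'rV[R]_N) :
  0 < beta0 -> 0 <= p ->
  (S_plus s beta0 E <= (beta0 `^ (- p))%:E * S_pow s p E)%E.
Proof.
move=> b0 p0; apply: esum_le_pmul => //.
- exact: powR_ge0.
- by move=> q; rewrite lee_fin mulr_ge0 ?powR_ge0.
move=> q /= bq; rewrite -EFinM lee_fin mulrA ler_peMl ?powR_ge0//.
rewrite powRN mulrC ler_pdivlMr ?powR_gt0// mul1r.
by apply: ge0_ler_powR => //; rewrite nnegrE ?(le_trans _ bq)// ltW.
Qed.

Lemma S_pow_ge0 (R : realType) (N : nat) (s p : R) (E : set 'rV[R]_N) :
  (0 <= S_pow s p E)%E.
Proof. by apply: esum_ge0 => q _; rewrite lee_fin mulr_ge0 ?powR_ge0. Qed.

Lemma S_plus_ge0 (R : realType) (N : nat) (s beta0 : R) (E : set 'rV[R]_N) :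
  (0 <= S_plus s beta0 E)%E.
Proof. by apply: esum_ge0 => q _; rewrite lee_fin powR_ge0. Qed.

Theorem corollary1p2 (R : realType) (N : nat) (s beta0 : R)
    (hN : (2 <= N)%N) (hs : 1 < s) (hbeta0 : 0 < beta0 < 1)
    (hprop : beta0_property N s beta0) :
  (forall (p : R) (E : set 'rV[R]_N),
     0 < p -> E !=set0 -> bounded_set E -> (S_pow s p E < +oo)%E ->
     exists Gamma : set 'rV[R]_N, holder_curve s Gamma /\ E `<=` Gamma) /\
  exists C : R, forall (p : R) (E : set 'rV[R]_N),
    0 < p -> E !=set0 -> bounded_set E -> (S_pow s p E < +oo)%E ->
    exists (H : R) (f : R -> 'rV[R]_N),
      [/\ holder_map s H f,
          E `<=` f @` `[0, 1] &
          H <= C * (diam E + beta0 `^ (- p) * diam E `^ (1 - s)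
                             * fine (S_pow s p E))].
Proof.
have /andP[b0 _] := hbeta0; have [C hC] := hprop.
set quantitative := (X in _ /\ X).
suff holder : quantitative.
  split=> // p E p0 E0 bE finE.
  have [C' /(_ p E p0 E0 bE finE)[H [f [hf Ef _]]]] := holder.
  by exists (f @` `[0, 1]); split=> //; exists H, f.
exists `|C| => p E p0 E0 bE finE.
have le_plus := S_plus_le_S_pow _ _ s p beta0 E b0 (ltW p0).
have fin_pow : S_pow s p E \is a fin_num by rewrite ge0_fin_numE ?S_pow_ge0.
have fin_plus : (S_plus s beta0 E < +oo)%E.
  by apply: le_lt_trans le_plus _; rewrite -(fineK fin_pow) -EFinM ltry.
have [H [f [hf Ef hH]]] := hC E E0 bE fin_plus.
exists H, f; split=> //; apply: le_trans hH _.
have fine_le : fine (S_plus s beta0 E) <= beta0 `^ (- p) * fine (S_pow s p E).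
  by rewrite -lee_fin EFinM !fineK// ge0_fin_numE ?S_plus_ge0.
apply: (@le_trans _ _
  (`|C| * (diam E + diam E `^ (1 - s) * fine (S_plus s beta0 E)))).
  apply: ler_wpM2r; last exact: ler_norm.
  by rewrite addr_ge0 ?diam_ge0// mulr_ge0 ?powR_ge0// fine_ge0 ?S_plus_ge0.
rewrite ler_wpM2l// lerD2l (mulrC (beta0 `^ _)) -mulrA.
by rewrite ler_wpM2l ?powR_ge0.
Qed.
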